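(* In the setting described in the context (under the pricing oracle, Lipschitz, and substitutability assumptions), let $(\lambda,\mu)$ be the output of the Dual Frank Wolfe algorithm run with tolerance $\epsilon>0$, and let $$\mathrm{ALG}:=\sum_{\ell\in\mathcal{L}}s_\ell(\lambda_\ell)+\mathbb{E}_{X\sim q(\lambda)}[C(X)],\qquad \mathrm{OPT}:=\min_{P_\ell\in\mathcal{P}_\ell\,\forall\ell}\ \sum_{\ell\in\mathcal{L}}S_\ell(P_\ell)+\mathbb{E}_{X\sim Q(P)}[C(X)].$$ Then $$\mathrm{ALG}-\mathrm{OPT}\le A_{\max}\Big(\frac{\sqrt{L}}{2}+2\gamma\log_2(4L)\Big)+\epsilon.$$
   Context: Setting: a finite set $\mathcal{L}$ of $L$ loads with alternate-channel costs $a_\ell>0$; $B$ contracts; a downward-closed family $\mathcal{A}\subseteq 2^{\mathcal{L}}$ of load sets executable by one contract, every load lying in some $A\in\mathcal{A}$; $u:=\max_{A\in\mathcal{A}}|A|$; there is $\nu\in(0,1/2)$ with $B>\nu L$ and $uB<(1-\nu)L$. $A_{\max}:=\max_{A\in\mathcal{A}}\sum_{\ell\in A}a_\ell$. For $X\in\{0,1\}^L$, $C(X)$ is the optimal value of: minimize $\sum_i a_iz_i$ s.t. $z_i+\sum_{A\ni i}x_A\ge X_i$ for all $i$, $\sum_A x_A\le B$, $z_i,x_A\in\{0,1\}$. For $X\in\mathbb{Z}_+^L$, $\mathcal{B}(X):=\min\{\sum_Ax_A:\sum_{A\ni i}x_A\ge X_i\ \forall i,\ x_A\in\mathbb{Z}_+\}$;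 for $d\in\mathbb{R}_+^L$, $\mathcal{B}(d):=\mathbb{E}[\mathcal{B}(\lfloor d\rfloor+Z)]$ with independent $Z_i\sim\mathrm{Bernoulli}(d_i-\lfloor d_i\rfloor)$. Spot side: for each load $\ell$ a nonempty set $\mathcal{P}_\ell$ of implementable pricing policies; $S_\ell(P)\ge0$ is the expected payment when terminal cost is zero and $Q_\ell(P)\in[0,1]$ the non-procurement probability; non-procurement is independent across loads, and $X\sim Q(P)$ (resp. $X\sim q$) denotes $X\in\{0,1\}^L$ with independent $X_\ell\sim\mathrm{Bernoulli}(Q_\ell(P_\ell))$ (resp. $\mathrm{Bernoulli}(q_\ell)$). Pricing oracle assumption: for all $\ell$ and $w\ge0$ there is $P^*_\ell(w)\in\arg\min_{P\in\mathcal{P}_\ell}S_\ell(P)+Q_\ell(P)w$, and $Q_\ell(P^*_\ell(0))=1$; set $s_\ell(w):=S_\ell(P^*_\ell(w))$, $q_\ell(w):=Q_\ell(P^*_\ell(w))$, $q(\lambda):=(q_\ell(\lambda_\ell))_\ell$. Lipschitz assumption: each $q_\ell$ is $\beta_\ell$-Lipschitz on $\mathbb{R}_+$ for some $\beta_\ell>0$. Substitutability assumption: there is $\gamma\in[0,B/4)$ with $\mathcal{B}(X/2)\le\mathcal{B}(X)/2+\gamma$ for all $X\in\mathbb{R}_+^L$. Dual Frank Wolfe algorithm: initialize $\lambda=0$, $\mu=0$, $\eta_t=2/(t+2)$, $g=\infty$. While $g>\epsilon$: compute $q=q(\lambda)$; compute $(\hat\lambda,\hat\mu)\in\arg\max\{\tilde\lambda^\top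 q-\tilde\mu B:\sum_{\ell\in A}\tilde\lambda_\ell\le\tilde\mu\ \forall A\in\mathcal{A},\ 0\le\tilde\lambda\le a,\ \tilde\mu\ge0\}$; set $g\leftarrow(\hat\lambda^\top q-\hat\mu B)-(\lambda^\top q-\mu B)$; if $g>\epsilon$, set $\lambda\leftarrow(1-\eta_t)\lambda+\eta_t\hat\lambda$, $\mu\leftarrow(1-\eta_t)\mu+\eta_t\hat\mu$. Output $(\lambda,\mu)$ and policies $P^*_\ell(\lambda_\ell)$. *)

(* Defs.v *)
From mathcomp Require Import all_boot all_order all_algebra.
From mathcomp Require Import all_classical all_reals all_analysis.

Set Implicit Arguments.
Unset Strict Implicit.
Unset Printing Implicit Defensive.

Import Order.TTheory GRing.Theory Num.Theory.
Import numFieldNormedType.Exports.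

Local Open Scope classical_set_scope.
Local Open Scope ring_scope.

(* The set {0,1}^load is {ffun load -> bool}; the expectation of f(X), with X
   a vector of independent Bernoulli(p_l) coordinates, is a finite sum. *)
Definition bernoulli_expect (R : realType) (load : finType) (p : load -> R)
    (f : {ffun load -> bool} -> R) : R :=
  \sum_(X : {ffun load -> bool}) (\prod_l bernoulli_pmf (p l) (X l)) * f X.

Section Contracts.
Variables (R : realType) (load : finType).
Variables (AA : {set {set load}}) (B : nat) (a : load -> R).

(* The costs are nonnegative and AA is nonempty in all uses, so the default
   value 0 does not affect the maximum. *)
Definition Amax : R := \big[Num.max/0]_(A in AA) \sum_(l in A) a l.

(* A point of the integer program is a pair (z, x); x is indexed by all load
   sets, but only its entries at members of AA matter. *)
Definition clearing_point : finType :=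
  ({ffun load -> bool} * {ffun {set load} -> bool})%type.

Definition clearing_feasible (X : {ffun load -> bool})
    (zx : clearing_point) : bool :=
  [forall i, (X i <= zx.1 i + \sum_(A in AA | i \in A) zx.2 A)%N]
  && (\sum_(A in AA) zx.2 A <= B)%N.

Definition clearing_cost (zx : clearing_point) : R :=
  \sum_i a i * (zx.1 i)%:R.

Definition clearing_default (X : {ffun load -> bool}) : clearing_point :=
  (X, [ffun=> false]).

(* C(X). [arg min] needs a feasible default point: z = X, x = 0. *)
Definition clearing (X : {ffun load -> bool}) : R :=
  clearing_cost
    [arg min_(zx < clearing_default X | clearing_feasible X zx)
       clearing_cost zx]%O.

Lemma clearing_default_feasible X : clearing_feasible X (clearing_default X).
Proof.
apply/andP; split => /=; first by apply/forallP => i; exact: leq_addr.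
by rewrite big1 // => A _; rewrite ffunE.
Qed.

Lemma clearingP X :
  (exists2 zx, clearing_feasible X zx & clearing X = clearing_cost zx) /\
  (forall zx, clearing_feasible X zx -> clearing X <= clearing_cost zx).
Proof.
rewrite /clearing.
case: arg_minP; first exact: clearing_default_feasible.
by move=> zx fzx lezx; split; [exists zx | exact: lezx].
Qed.

Definition covering_size (X : load -> nat) (n : nat) : Prop :=
  exists x : {set load} -> nat,
    (forall i, (X i <= \sum_(A in AA | i \in A) x A)%N) /\
    n = (\sum_(A in AA) x A)%N.

(* The function B on Z_+^load. The default 0 is irrelevant as soon as every
   load belongs to a member of AA. *)
Definition contracts_nat (X : load -> nat) : nat :=
  xget 0%N [set n | covering_size X n /\
                    forall m, covering_size X m -> (n <= m)%N].

(* The extension of B to R_+^load by independent randomized rounding. *)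
Definition contracts (d : load -> R) : R :=
  bernoulli_expect (fun i => d i - (Num.truncn (d i))%:R)
    (fun Z => (contracts_nat (fun i => (Num.truncn (d i) + Z i)%N))%:R).

Variables (q : load -> R -> R) (eps : R).

Definition dual_feasible (lam : load -> R) (mu : R) : Prop :=
  [/\ forall A, A \in AA -> \sum_(l in A) lam l <= mu,
      forall l, 0 <= lam l <= a l
    & 0 <= mu].

Definition dual_value (p lam : load -> R) (mu : R) : R :=
  \sum_l lam l * p l - mu * B%:R.

Definition dual_argmax (p lam : load -> R) (mu : R) : Prop :=
  dual_feasible lam mu /\
  forall lam' mu', dual_feasible lam' mu' ->
    dual_value p lam' mu' <= dual_value p lam mu.

Definition dfw_prob (lam : load -> R) : load -> R := fun l => q l (lam l).

Definition dfw_gap (lam : load -> R) (mu : R) (hlam : load -> R) (hmu : R) : R :=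
  dual_value (dfw_prob lam) hlam hmu - dual_value (dfw_prob lam) lam mu.

Definition dfw_eta (t : nat) : R := 2 / (t%:R + 2).

(* [dfw_iter t lam mu]: (lam, mu) can be the iterate held after t updates;
   the choice of the maximizer in each iteration is arbitrary. *)
Inductive dfw_iter : nat -> (load -> R) -> R -> Prop :=
| dfw_init : dfw_iter 0%N (fun=> 0) 0
| dfw_step t lam mu hlam hmu :
    dfw_iter t lam mu ->
    dual_argmax (dfw_prob lam) hlam hmu ->
    eps < dfw_gap lam mu hlam hmu ->
    dfw_iter t.+1
      (fun l => (1 - dfw_eta t) * lam l + dfw_eta t * hlam l)
      ((1 - dfw_eta t) * mu + dfw_eta t * hmu).

Definition dfw_output (lam : load -> R) (mu : R) : Prop :=
  exists t hlam hmu,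
    [/\ dfw_iter t lam mu,
        dual_argmax (dfw_prob lam) hlam hmu
      & dfw_gap lam mu hlam hmu <= eps].

End Contracts.

Section Spot.
Variables (R : realType) (load : finType).
Variables (AA : {set {set load}}) (B : nat) (a : load -> R).
Variables (policy : load -> Type) (S Q : forall l, policy l -> R).
Arguments S {l} _.
Arguments Q {l} _.
Variable Pstar : forall l, R -> policy l.

Definition spot_pay (l : load) (w : R) : R := S (Pstar l w).
Definition spot_prob (l : load) (w : R) : R := Q (Pstar l w).

Definition policy_cost (P : forall l, policy l) : R :=
  \sum_l S (P l) + bernoulli_expect (fun l => Q (P l)) (clearing AA B a).

(* The infimum is the minimum whenever the latter is attained (see
   [opt_cost_min]). *)
Definition opt_cost : R := inf (range policy_cost).

Lemma opt_cost_min P :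
  (forall P', policy_cost P <= policy_cost P') -> opt_cost = policy_cost P.
Proof.
move=> minP; apply/eqP; rewrite eq_le; apply/andP; split.
  apply: ge_inf; last by exists P.
  by exists (policy_cost P) => _ [P' _ <-]; exact: minP.
apply: lb_le_inf; first by exists (policy_cost P), P.
by move=> _ [P' _ <-]; exact: minP.
Qed.

Definition alg_cost (lam : load -> R) : R :=
  \sum_l spot_pay l (lam l)
  + bernoulli_expect (fun l => spot_prob l (lam l)) (clearing AA B a).

End Spot.

Definition log2 (R : realType) (x : R) : R := ln x / ln 2.

(* Main.v *)
(** Every dual feasible (lam, mu) satisfies C(X) >= lam^T X - mu B, so by the
    pricing oracle OPT is at least the dual value at the output, and the stopping
    rule reduces the claim to comparing E C(X), X ~ q, with the optimal value V
    of the dual linear program at q.  By linear programming duality (only up to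
    an arbitrary error, which suffices), some fractional plan x with total weight
    at most B serves a part d <= q of the demand while the alternate channel
    serves q - d at cost at most about V.  Raising coordinates from d to q costs
    at most a^T (q - d), and E C(Y), Y ~ d, is at most A_max times the expected
    excess over B of the size N(Y) of an optimal cover.  As N has increments at
    most 1, its variance is at most L / 4; and iterating substitutability along
    d, 2 d, 4 d, ... gives E N(Y) <= B + 2 gamma.  Since log2 (4 L) >= 1, this is
    more than enough. *)
Require Import Defs.
From mathcomp Require Import all_boot all_order all_algebra.
From mathcomp Require Import all_classical all_reals all_analysis.
From mathcomp Require Import ring lra zify.

Set Implicit Arguments.
Unset Strict Implicit.
Unset Printing Implicit Defensive.

Import Order.TTheory GRing.Theory Num.Theory.
Import numFieldNormedType.Exports.

Local Open Scope classical_set_scope.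
Local Open Scope ring_scope.

(** * Expectations over independent Bernoulli vectors, one coordinate at a time *)

Section BernoulliExpectation.
Variables (R : realType) (load : finType).
Implicit Types (p q : load -> R) (X Y : {ffun load -> bool}).
Implicit Types (f g : {ffun load -> bool} -> R).

Definition setc X (i : load) (b : bool) : {ffun load -> bool} :=
  [ffun l => if l == i then b else X l].

(** The conditional expectation of [f] given all coordinates other than [i]. *)
Definition average p (i : load) f X : R :=
  p i * f (setc X i true) + (1 - p i) * f (setc X i false).

(** Supports inductions on the list [s] of coordinates still to be averaged out; once it is empty,
    [f] is constant. *)
Definition depends_on (s : seq load) f : Prop :=
  forall X Y, {in s, X =1 Y} -> f X = f Y.

Lemma setc_setc X i b c : setc (setc X i b) i c = setc X i c.
Proof. by apply/ffunP => l; rewrite !ffunE; case: eqP. Qed.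

Lemma setc_comm X i j b c : i != j ->
  setc (setc X i b) j c = setc (setc X j c) i b.
Proof.
move=> ij; apply/ffunP => l; rewrite !ffunE.
by case: (eqVneq l j) => // ->; rewrite eq_sym (negPf ij).
Qed.

Lemma setc_id X i : setc X i (X i) = X.
Proof. by apply/ffunP => l; rewrite !ffunE; case: eqP => [->|]. Qed.

Lemma bernoulli_weight_ge0 p X : (forall l, 0 <= p l <= 1) ->
  0 <= \prod_l bernoulli_pmf (p l) (X l).
Proof. by move=> p01; apply: prodr_ge0 => l _; exact: bernoulli_pmf_ge0. Qed.

Lemma bernoulli_weight_sum p :
  \sum_(X : {ffun load -> bool}) \prod_l bernoulli_pmf (p l) (X l) = 1.
Proof.
rewrite -(bigA_distr_bigA (fun l b => bernoulli_pmf (p l) b)) /=.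
by rewrite big1 // => l _; rewrite big_bool /=; ring.
Qed.

Lemma bernoulli_expect_le p f g : (forall l, 0 <= p l <= 1) ->
  (forall X, f X <= g X) -> bernoulli_expect p f <= bernoulli_expect p g.
Proof.
move=> p01 fg; apply: ler_sum => X _.
by apply: ler_wpM2l => //; exact: bernoulli_weight_ge0.
Qed.

Lemma bernoulli_expectD p f g :
  bernoulli_expect p (fun X => f X + g X)
  = bernoulli_expect p f + bernoulli_expect p g.
Proof. by rewrite -big_split; apply: eq_bigr => X _ /=; rewrite mulrDr. Qed.

Lemma bernoulli_expectZ p c f :
  bernoulli_expect p (fun X => c * f X) = c * bernoulli_expect p f.
Proof.
by rewrite /bernoulli_expect mulr_sumr; apply: eq_bigr => X _; rewrite mulrCA.
Qed.

Lemma bernoulli_expect_cst p c : bernoulli_expect p (fun=> c) = c.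
Proof. by rewrite /bernoulli_expect -mulr_suml bernoulli_weight_sum mul1r. Qed.

Lemma eq_bernoulli_expect p f g : f =1 g ->
  bernoulli_expect p f = bernoulli_expect p g.
Proof. by move=> fg; apply: eq_bigr => X _; rewrite fg. Qed.

Lemma bernoulli_expect_sum p (I : finType) (F : I -> {ffun load -> bool} -> R) :
  bernoulli_expect p (fun X => \sum_i F i X) = \sum_i bernoulli_expect p (F i).
Proof. by rewrite exchange_big; apply: eq_bigr => X _; rewrite mulr_sumr. Qed.

Lemma sum_setc (F : {ffun load -> bool} -> R) i :
  \sum_X F X = \sum_(X : {ffun load -> bool} | X i)
                 (F (setc X i true) + F (setc X i false)).
Proof.
rewrite (bigID (fun X : {ffun load -> bool} => X i)) big_split /=; congr (_ + _).
  by apply: eq_bigr => X Xi; rewrite -[in LHS](setc_id X i) Xi.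
rewrite (reindex_onto (fun X => setc X i false) (fun X => setc X i true)) /=.
  apply: eq_bigl => X; rewrite !ffunE eqxx setc_setc /=.
  apply/eqP/idP => [<-|Xi]; first by rewrite ffunE eqxx.
  by rewrite -[RHS](setc_id X i) Xi.
by move=> X /negPf Xi; rewrite setc_setc -[RHS](setc_id X i) Xi.
Qed.

(** The tower property: pairing the vectors that differ only at [i], the weight factors into the law
    of coordinate [i] and a common product. *)
Lemma bernoulli_expect_average p i f :
  bernoulli_expect p (average p i f) = bernoulli_expect p f.
Proof.
rewrite /bernoulli_expect [LHS](sum_setc _ i) [RHS](sum_setc _ i).
apply: eq_bigr => X _; rewrite /average !setc_setc.
have w b : \prod_l bernoulli_pmf (p l) (setc X i b l)
    = bernoulli_pmf (p i) b * \prod_(l | l != i) bernoulli_pmf (p l) (X l).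
  rewrite (bigD1 i) //= ffunE eqxx; congr (_ * _).
  by apply: eq_bigr => l /negPf li; rewrite ffunE li.
rewrite !w /=; ring.
Qed.

Lemma bernoulli_expect_coord p i :
  bernoulli_expect p (fun X => (X i)%:R) = p i.
Proof.
rewrite -(bernoulli_expect_average _ i) -[RHS](bernoulli_expect_cst p).
by apply: eq_bernoulli_expect => X; rewrite /average !ffunE eqxx /=; ring.
Qed.

Lemma depends_on_average p i s f :
  depends_on (i :: s) f -> depends_on s (average p i f).
Proof.
move=> fs X Y XY; rewrite /average; congr (_ * _ + _ * _); apply: fs => l;
  by rewrite inE !ffunE; case: eqP => //= _ /XY.
Qed.

Lemma depends_on_nil f p : depends_on [::] f ->
  forall X, f X = bernoulli_expect p f.
Proof.
move=> f0 X; rewrite -[LHS](bernoulli_expect_cst p).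
by apply: eq_bernoulli_expect => Y; exact: f0.
Qed.

Lemma depends_on_enum f : depends_on (enum load) f.
Proof.
by move=> X Y XY; congr f; apply/ffunP => l; apply: XY; rewrite mem_enum.
Qed.

(** Coordinates are switched from [p] to [q] one by one; switching [i] changes the average by
    [q i - p i] times an increment of [f], which is at most [c i]. *)
Lemma bernoulli_expect_incr p q (c : load -> R) f :
  (forall l, 0 <= p l <= q l) -> (forall l, q l <= 1) -> (forall l, 0 <= c l) ->
  (forall X l, f (setc X l true) <= f (setc X l false) + c l) ->
  bernoulli_expect q f <= bernoulli_expect p f + \sum_l c l * (q l - p l).
Proof.
move=> p0q q1 c0; rewrite -big_enum /=.
have p01 l : 0 <= p l <= 1.
  by case/andP: (p0q l) => -> /le_trans -> //; exact: q1.
have q01 l : 0 <= q l <= 1.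
  by rewrite q1 andbT; case/andP: (p0q l); exact: le_trans.
elim: (enum load) f (depends_on_enum f) => [|i s IHs] f fs f_incr.
  rewrite big_nil addr0 -(depends_on_nil q fs [ffun=> true]).
  by rewrite -(depends_on_nil p fs [ffun=> true]).
rewrite big_cons -(bernoulli_expect_average q i).
apply: le_trans (IHs _ (depends_on_average (i := i) q fs) _) _ => [X l|].
  rewrite /average; have [<-|il] := eqVneq i l.
    by rewrite !setc_setc lerDl.
  rewrite !(@setc_comm X l i) 1?eq_sym //.
  have := f_incr (setc X i true) l; have := f_incr (setc X i false) l.
  by case/andP: (q01 i); nra.
rewrite addrA lerD2r -[in leRHS](bernoulli_expect_average p i).
rewrite -[X in _ + X](bernoulli_expect_cst p) -bernoulli_expectD.
apply: bernoulli_expect_le => // X; rewrite /average.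
have := f_incr X i; case/andP: (p0q i) => _; nra.
Qed.

(** By the law of total variance, averaging out one coordinate removes the mean of a conditional
    variance, which is at most 1/4; averaging preserves the bound on the increments. *)
Lemma bernoulli_variance_le p f :
  (forall l, 0 <= p l <= 1) ->
  (forall X l, `|f (setc X l true) - f (setc X l false)| <= 1) ->
  bernoulli_expect p (fun X => f X ^+ 2)
  <= bernoulli_expect p f ^+ 2 + #|load|%:R / 4.
Proof.
move=> p01; rewrite cardE.
elim: (enum load) f (depends_on_enum f) => [|i s IHs] f fs f_lip.
  rewrite mul0r addr0 -[leRHS](bernoulli_expect_cst p).
  by apply: bernoulli_expect_le => // X; rewrite -(depends_on_nil p fs X).
rewrite /= -[X in _ <= X ^+ 2 + _](bernoulli_expect_average p i).
rewrite -natr1 mulrDl addrA.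
apply: le_trans (_ : _ <=
  bernoulli_expect p (fun X => average p i f X ^+ 2) + 1 / 4) _; last first.
  rewrite lerD2r; apply: IHs; first exact: depends_on_average.
  move=> X l; rewrite /average; have [<-|il] := eqVneq i l.
    by rewrite !setc_setc subrr normr0.
  rewrite !(@setc_comm X l i) 1?eq_sym //.
  have := f_lip (setc X i true) l; have := f_lip (setc X i false) l.
  rewrite !ler_norml => /andP[? ?] /andP[? ?].
  by case/andP: (p01 i) => ? ?; apply/andP; split; nra.
rewrite -(bernoulli_expect_average p i) -[X in _ + X](bernoulli_expect_cst p).
rewrite -bernoulli_expectD.
apply: bernoulli_expect_le => // X; rewrite /average.
have := f_lip X i; set u := f _; set v := f _.
rewrite ler_norml => /andP[uv1 uv2]; case/andP: (p01 i) => p0 p1.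
have uv : (u - v) ^+ 2 <= 1 by nra.
have pp : p i * (1 - p i) <= 1 / 4 by have := sqr_ge0 (p i - 1 / 2); nra.
(* Squared mean plus variance of a variable with the two values [u] and [v]. *)
have -> : p i * u ^+ 2 + (1 - p i) * v ^+ 2 =
  (p i * u + (1 - p i) * v) ^+ 2 + p i * (1 - p i) * (u - v) ^+ 2 by ring.
rewrite lerD2l; apply: le_trans pp.
by rewrite ler_piMr // mulr_ge0 // subr_ge0.
Qed.

End BernoulliExpectation.

(** * Sizes of integral and fractional covers *)

Section Covering.
Variables (R : realType) (load : finType) (AA : {set {set load}}).
Hypothesis AA_cover : forall l, exists2 A : {set load}, A \in AA & l \in A.
Implicit Types (X Y : load -> nat) (Z : {ffun load -> bool}).

Lemma contracts_natP X : covering_size AA X (contracts_nat AA X) /\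
  forall n, covering_size AA X n -> (contracts_nat AA X <= n)%N.
Proof.
apply: (@xgetPex _ 0%N [set n | covering_size AA X n /\
  forall m, covering_size AA X m -> (n <= m)%N]).
have ex_size : exists n, `[< covering_size AA X n >].
  (* A crude cover: every member of [AA] is taken as often as the total demand. *)
  exists (\sum_(A in AA) \sum_l X l)%N; apply/asboolP.
  exists (fun=> \sum_l X l)%N; split=> // i.
  have [A AAA iA] := AA_cover i.
  rewrite (bigD1 A) ?AAA //= (bigD1 i) //= -addnA; exact: leq_addr.
have [n /asboolP nX nmin] := ex_minnP ex_size; exists n; split=> // m mX.
by apply: nmin; apply/asboolP.
Qed.

Lemma contracts_nat_le X Y : (forall l, (X l <= Y l)%N) ->
  (contracts_nat AA X <= contracts_nat AA Y)%N.
Proof.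
move=> XY; have [_ minX] := contracts_natP X.
have [[x [xY eN]] _] := contracts_natP Y.
apply: minX; exists x; split=> // i; exact: leq_trans (XY i) (xY i).
Qed.

(** One more copy of a set containing [i] turns a cover of [X] into a cover of [Y]. *)
Lemma contracts_nat_succ X Y i :
  (forall l, (Y l <= X l + (l == i))%N) ->
  (contracts_nat AA Y <= (contracts_nat AA X).+1)%N.
Proof.
move=> YX; have [_ minY] := contracts_natP Y.
have [[x [xX ->]] _] := contracts_natP X.
have [A AAA iA] := AA_cover i.
apply: minY; exists (fun A' => x A' + (A' == A))%N; split=> [l|].
  rewrite big_split /=; apply: leq_trans (YX l) (leq_add (xX l) _).
  by case: eqP => // ->; rewrite (bigD1 A) ?AAA //= eqxx.
rewrite big_split /= -addn1; congr (_ + _)%N.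
by rewrite (bigD1 A) //= eqxx big1 // => A' /andP[_ /negPf ->].
Qed.

Definition coverage (x : {set load} -> R) (l : load) : R :=
  \sum_(A in AA | l \in A) x A.

(* Rounding [x A] up twice absorbs both the rounding of [x] and the excess of
   at most one per load of [X] over [d]. *)
Lemma contracts_nat_fractional X (d : load -> R) (x : {set load} -> R) :
  (forall A, 0 <= x A) -> (forall l, d l <= coverage x l) ->
  (forall l, (X l)%:R <= d l + 1) ->
  (contracts_nat AA X)%:R <= \sum_(A in AA) x A + 2 * #|AA|%:R.
Proof.
move=> x0 dx Xd; have [_ minX] := contracts_natP X.
pose y A := (Num.truncn (x A)).+2.
have yX : covering_size AA X (\sum_(A in AA) y A)%N.
  exists y; split=> // i; rewrite -(ler_nat R) natr_sum.
  have [A AAA iA] := AA_cover i.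
  have AiA : (A \in AA) && (i \in A) by rewrite AAA.
  apply: le_trans (Xd i) _; apply: le_trans (lerD (dx i) (lexx 1)) _.
  rewrite /coverage (bigD1 A AiA) [leRHS](bigD1 A AiA) /= addrAC.
  apply: lerD.
    by rewrite /y -natr1 lerD2r; apply/ltW; exact: truncnS_gt.
  apply: ler_sum => A' _; rewrite /y -natr1 -[leLHS]addr0.
  by apply: lerD => //; apply/ltW; exact: truncnS_gt.
have := minX _ yX; rewrite -(ler_nat R) natr_sum => /le_trans; apply.
apply: le_trans (_ : _ <= \sum_(A in AA) (x A + 2)) _.
  apply: ler_sum => A _; rewrite /y -addn2 natrD lerD2r truncn_le //.
by rewrite big_split /= sumr_const mulr_natr.
Qed.

Lemma contracts_fractional (d : load -> R) (x : {set load} -> R) :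
  (forall A, 0 <= x A) -> (forall l, 0 <= d l <= coverage x l) ->
  contracts AA d <= \sum_(A in AA) x A + 2 * #|AA|%:R.
Proof.
move=> x0 dx.
rewrite -[leRHS](bernoulli_expect_cst
  (fun i => d i - (Num.truncn (d i))%:R)).
apply: bernoulli_expect_le => [l|Z].
  have /andP[d0 _] := dx l; have := truncnS_gt (d l); rewrite -natr1.
  have : (Num.truncn (d l))%:R <= d l by rewrite truncn_le.
  by move=> ? ?; apply/andP; split; lra.
apply: (contracts_nat_fractional (d := d)) => // l; first by case/andP: (dx l).
have /andP[d0 _] := dx l; rewrite natrD; apply: lerD; first by rewrite truncn_le.
by rewrite lern1 leq_b1.
Qed.

Definition contracts_bin (Z : {ffun load -> bool}) : nat :=
  contracts_nat AA (fun l => nat_of_bool (Z l)).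

Lemma contracts_expect (d : load -> R) : (forall l, 0 <= d l < 1) ->
  contracts AA d = bernoulli_expect d (fun Z => (contracts_bin Z)%:R).
Proof.
move=> d01; rewrite /contracts.
have d0 l : Num.truncn (d l) = 0%N by apply: truncn_def.
congr (bernoulli_expect _ _); apply/funext => Z; first by rewrite d0 subr0.
by congr ((contracts_nat _ _)%:R); apply/funext => l; rewrite d0.
Qed.

Section Substitutable.
Variable gamma : R.
Hypothesis substitutable : forall X : load -> R, (forall l, 0 <= X l) ->
  contracts AA (fun l => X l / 2) <= contracts AA X / 2 + gamma.

(** Substitutability is applied to [2 d], [4 d], ..., [2 ^+ k * d]; the last term is the sum of the
    losses [gamma / 2 ^+ j] for [j < k]. *)
Lemma contracts_scale k (d : load -> R) : (forall l, 0 <= d l) ->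
  contracts AA d <= contracts AA (fun l => 2 ^+ k * d l) / 2 ^+ k
                    + 2 * gamma * (1 - (2 ^+ k)^-1).
Proof.
move=> d0; elim: k => [|k IHk].
  rewrite expr0 invr1 subrr mulr0 addr0 mulr1 le_eqVlt; apply/orP; left; apply/eqP.
  by congr (contracts _ _); apply/funext => l; rewrite mul1r.
apply: le_trans IHk _.
have d20 l : 0 <= 2 ^+ k.+1 * d l by rewrite mulr_ge0 ?exprn_ge0.
have := substitutable d20.
have -> : (fun l => 2 ^+ k.+1 * d l / 2) = (fun l => 2 ^+ k * d l).
  by apply/funext => l; rewrite exprS; field.
have k0 : 0 < (2 ^+ k : R)^-1 by rewrite invr_gt0 exprn_gt0.
rewrite exprS invfM; nra.
Qed.

(* Substitutability makes the integrality gap of a scaled-up demand vanish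
   relative to its size, at the total price gamma (1 + 1/2 + 1/4 + ...). *)
Lemma contracts_le_fractional (d : load -> R) (x : {set load} -> R) :
  0 <= gamma ->
  (forall A, 0 <= x A) -> (forall l, 0 <= d l <= coverage x l) ->
  contracts AA d <= \sum_(A in AA) x A + 2 * gamma.
Proof.
move=> gamma0 x0 dx; apply/ler_addgt0Pr => e e0.
have [k ke] : exists k, 2 * #|AA|%:R / 2 ^+ k < e.
  (* This exponent is large enough because [n < 2 ^ n]. *)
  exists (Num.truncn (2 * #|AA|%:R / e)).
  rewrite ltr_pdivrMr ?exprn_gt0 // [ltRHS]mulrC -ltr_pdivrMr //.
  apply: lt_le_trans (truncnS_gt _) _.
  by rewrite -natrX ler_nat ltn_expl.
have scaled : contracts AA (fun l => 2 ^+ k * d l)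
    <= \sum_(A in AA) 2 ^+ k * x A + 2 * #|AA|%:R.
  apply: contracts_fractional => [A|l]; first by rewrite mulr_ge0 ?exprn_ge0.
  rewrite /coverage -mulr_sumr.
  have /andP[d0 dc] := dx l; rewrite mulr_ge0 ?exprn_ge0 //=.
  by rewrite ler_wpM2l ?exprn_ge0.
apply: le_trans (contracts_scale k _) _ => [l|]; first by case/andP: (dx l).
have k0 : 0 < (2 ^+ k : R)^-1 by rewrite invr_gt0 exprn_gt0.
rewrite -mulr_sumr in scaled.
have := ler_wpM2r (ltW k0) scaled.
rewrite mulrDl mulrAC divff ?mul1r; last by rewrite gt_eqF // exprn_gt0.
have : 0 <= 2 * gamma * (2 ^+ k)^-1 by rewrite !mulr_ge0 // ltW.
rewrite mulrBr mulr1; lra.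
Qed.

End Substitutable.

Lemma contracts_nat_variance (d : load -> R) : (forall l, 0 <= d l <= 1) ->
  bernoulli_expect d (fun Z => (contracts_bin Z)%:R ^+ 2)
  <= bernoulli_expect d (fun Z => (contracts_bin Z)%:R) ^+ 2
     + #|load|%:R / 4.
Proof.
move=> d01; apply: (@bernoulli_variance_le _ _ d
  (fun Z => (contracts_bin Z)%:R)) => // Z i.
have le1 : (contracts_bin (setc Z i false)
      <= contracts_bin (setc Z i true))%N.
  by apply: contracts_nat_le => l; rewrite !ffunE; case: eqP.
have le2 : (contracts_bin (setc Z i true)
      <= (contracts_bin (setc Z i false)).+1)%N.
  apply: (contracts_nat_succ (i := i)) => l; rewrite !ffunE.
  by case: eqP => //= _; rewrite addn0.
rewrite -natrB // normr_nat lern1; lia.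
Qed.

(* [max w 0 <= (w^2/c + c)/2], with [c] the bound on the standard deviation. *)
Lemma contracts_nat_excess (d : load -> R) (b : R) : (0 < #|load|)%N ->
  (forall l, 0 <= d l <= 1) ->
  bernoulli_expect d (fun Z => Num.max 0 ((contracts_bin Z)%:R - b))
  <= Num.sqrt #|load|%:R / 2
     + Num.max 0 (bernoulli_expect d (fun Z => (contracts_bin Z)%:R) - b).
Proof.
move=> L0 d01; have := contracts_nat_variance d01.
set m := bernoulli_expect d (fun Z => (contracts_bin Z)%:R) => var.
have s0 : 0 < Num.sqrt (#|load|%:R : R) by rewrite sqrtr_gt0 ltr0n.
have s2 : Num.sqrt (#|load|%:R : R) ^+ 2 = #|load|%:R by rewrite sqr_sqrtr.
rewrite -{}s2 in var; set s := Num.sqrt _ in var s0 *.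
(* With [N] the cover size, this is [(N - m) ^+ 2 / s + s / 4 + Num.max 0 (m - b)], expanded in
   powers of [N] so that linearity of expectation applies. The variance bound [s ^+ 2 / 4] turns the
   first term into a second [s / 4]. *)
pose g Z : R := s^-1 * (contracts_bin Z)%:R ^+ 2
  + (- 2 * m / s * (contracts_bin Z)%:R
     + (m ^+ 2 / s + s / 4 + Num.max 0 (m - b))).
apply: le_trans (_ : _ <= bernoulli_expect d g) _.
  apply: bernoulli_expect_le => // Z; rewrite /g.
  set N := (contracts_bin Z)%:R.
  have M0 : 0 <= Num.max 0 (m - b) by rewrite le_max lexx.
  have Mb : m - b <= Num.max 0 (m - b) by rewrite le_max lexx orbT.
  set M := Num.max 0 (m - b) in M0 Mb *.
  have -> : s^-1 * N ^+ 2 + (- 2 * m / s * N + (m ^+ 2 / s + s / 4 + M))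
      = (N - m - s / 2) ^+ 2 / s + (N - m) + M by field; rewrite gt_eqF.
  have sq1 : 0 <= (N - m - s / 2) ^+ 2 / s by rewrite divr_ge0 ?sqr_ge0 // ltW.
  have sq2 : 0 <= (N - m + s / 2) ^+ 2 / s by rewrite divr_ge0 ?sqr_ge0 // ltW.
  have e : (N - m - s / 2) ^+ 2 / s + (N - m) = (N - m) ^+ 2 / s + s / 4.
    by field; rewrite gt_eqF.
  rewrite ge_max; apply/andP; split; last lra.
  rewrite e addr_ge0 // addr_ge0 //; last lra.
  by rewrite divr_ge0 ?sqr_ge0 // ltW.
rewrite /g !bernoulli_expectD !bernoulli_expectZ !bernoulli_expect_cst -/m.
rewrite !addrA lerD2r.
have : s^-1 * bernoulli_expect d (fun Z => (contracts_bin Z)%:R ^+ 2)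
    <= s^-1 * (m ^+ 2 + s ^+ 2 / 4) by rewrite ler_wpM2l // invr_ge0 ltW.
have -> : s^-1 * (m ^+ 2 + s ^+ 2 / 4) = m ^+ 2 / s + s / 4.
  by field; rewrite gt_eqF.
have -> : - 2 * m / s * m = - 2 * (m ^+ 2 / s) by ring.
lra.
Qed.

End Covering.

(** * Lower and upper bounds on the clearing cost *)

Section Clearing.
Variables (R : realType) (load : finType) (AA : {set {set load}}) (B : nat).
Variable a : load -> R.
Hypothesis AA_cover : forall l, exists2 A : {set load}, A \in AA & l \in A.
Hypothesis a_gt0 : forall l, 0 < a l.
Implicit Types (X : {ffun load -> bool}) (lam : load -> R) (A : {set load}).

(** Price each unit of demand at [lam]: the alternate channel costs at least that price, and each of
    the at most [B] executed sets collects at most [mu]. *)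
Lemma clearing_weak_duality lam mu X : dual_feasible AA a lam mu ->
  dual_value B (fun l => (X l)%:R) lam mu <= clearing AA B a X.
Proof.
move=> [lamA lam_a mu0]; have [[[z x] /andP[/= zxX xB] ->] _] := clearingP AA B a X.
rewrite /dual_value /clearing_cost /= lerBlDr.
have lam0 l : 0 <= lam l by case/andP: (lam_a l).
apply: le_trans (_ : _ <= \sum_i (lam i * (z i)%:R
   + \sum_(A in AA | i \in A) lam i * (x A)%:R)) _.
  apply: ler_sum => i _; rewrite -mulr_sumr -mulrDr ler_wpM2l //.
  by have := forallP zxX i; rewrite -natr_sum -natrD ler_nat.
rewrite big_split /= lerD //.
  by apply: ler_sum => i _; rewrite ler_wpM2r //; case/andP: (lam_a i).
rewrite (exchange_big_dep (mem AA)) /=; last by move=> i A _ /andP[].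
apply: le_trans (_ : _ <= \sum_(A in AA) mu * (x A)%:R) _.
  apply: ler_sum => A AAA; rewrite -mulr_suml ler_wpM2r //.
  by apply: le_trans (lamA A AAA); rewrite le_eqVlt; apply/orP; left; apply/eqP;
     apply: eq_bigl => l; rewrite AAA.
by rewrite -mulr_sumr ler_wpM2l // -natr_sum ler_nat.
Qed.

(** An optimal plan without the demand of [l] stays feasible once [l] is sent to the alternate
    channel. *)
Lemma clearing_setc X l :
  clearing AA B a (setc X l true) <= clearing AA B a (setc X l false) + a l.
Proof.
have [[[z x] /andP[/= /forallP zxX xB] ->] _] := clearingP AA B a (setc X l false).
have [_ /(_ (setc z l true, x)) le_cost] := clearingP AA B a (setc X l true).
apply: le_trans (le_cost _) _.
  rewrite /clearing_feasible /= xB andbT; apply/forallP => i.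
  by have := zxX i; rewrite !ffunE; case: eqP.
rewrite /clearing_cost /= (bigD1 l) //= [X in _ <= X + _](bigD1 l) //=.
rewrite ffunE eqxx mulr1.
have -> : \sum_(i | i != l) a i * (setc z l true i)%:R
        = \sum_(i | i != l) a i * (z i)%:R.
  by apply: eq_bigr => i /negPf il; rewrite ffunE il.
by rewrite addrAC lerD2r lerDr mulr_ge0 // ltW.
Qed.

Lemma sum_le_Amax A : A \in AA -> \sum_(l in A) a l <= Amax AA a.
Proof. exact: (@le_bigmax_cond _ _ _ 0 A (mem AA) (fun A => \sum_(l in A) a l)). Qed.

Lemma Amax_ge0 : 0 <= Amax AA a.
Proof. exact: bigmax_ge_id. Qed.

(* Execute [B] of the sets of an optimal cover and pay [Amax] for each other. *)
Lemma clearing_le_excess X :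
  clearing AA B a X
  <= Amax AA a * Num.max 0 ((contracts_bin AA X)%:R - B%:R).
Proof.
rewrite /contracts_bin.
have [[y [yX ->]] _] := contracts_natP AA_cover (fun l => nat_of_bool (X l)).
(* Multiplicities are dropped: demand is 0 or 1 and the clearing program uses each set at most once.
   [T] consists of [B] sets of [C], or of all of them if there are fewer. *)
pose C := [set A in AA | (0 < y A)%N].
pose T := [set A in take B (enum C)].
have TC : T \subset C.
  by apply/fintype.subsetP => A; rewrite inE => /mem_take; rewrite mem_enum.
have cardT : #|T| = minn B #|C|.
  rewrite cardsE (card_uniqP _) ?take_uniq ?enum_uniq //.
  by rewrite size_take -cardE /minn.
have CAA A : A \in C -> A \in AA by rewrite inE => /andP[].
have cardC : (#|C| <= \sum_(A in AA) y A)%N.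
  rewrite -sum1_card (big_mkcond (mem C)) [leqRHS]big_mkcond /=.
  by apply: leq_sum => A _; rewrite inE; case: (A \in AA) => //=; case: (y A).
(* The alternate channel takes every load of a set left over, even if a set of [T] also contains it;
   the cost is then bounded set by set. *)
pose z := [ffun l => [exists A in C :\: T, l \in A]].
pose x := [ffun A => A \in T].
have [_ /(_ (z, x)) le_cost] := clearingP AA B a X.
apply: le_trans (le_cost _) _.
  apply/andP; split=> /=.
    apply/forallP => i; case Xi: (X i) => //.
    have : (0 < \sum_(A in AA | i \in A) y A)%N by have := yX i; rewrite Xi.
    rewrite lt0n sum_nat_eq0 negb_forall => /existsP[A].
    rewrite negb_imply -lt0n => /andP[/andP[AAA iA] yA].
    have AC : A \in C by rewrite inE AAA.
    have [AT|AT] := boolP (A \in T).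
      by rewrite (bigD1 A) ?AAA //= [x A]ffunE AT addnCA.
    rewrite ffunE; case: existsP => // -[]; exists A.
    by rewrite finset.in_setD AT AC.
  rewrite (eq_bigr (fun A => nat_of_bool (A \in T))); last by move=> A _; rewrite ffunE.
  rewrite -big_mkcondr sum1_card /=.
  apply: leq_trans (_ : #|T| <= _)%N; last by rewrite cardT geq_minl.
  by apply: subset_leq_card; apply/fintype.subsetP => A /andP[].
apply: le_trans (_ : _ <= \sum_(A in C :\: T) \sum_(l in A) a l) _.
  rewrite /clearing_cost /= (exchange_big_dep xpredT) //=.
  apply: ler_sum => l _; rewrite ffunE.
  case: existsP => [[A /andP[ACT lA]]|_] /=.
    rewrite mulr1 (bigD1 A) /= ?ACT // lerDl.
    by apply: sumr_ge0 => *; exact: ltW.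
  by rewrite mulr0; apply: sumr_ge0 => *; exact: ltW.
apply: le_trans (_ : _ <= \sum_(A in C :\: T) Amax AA a) _.
  by apply: ler_sum => A /finset.setDP[/CAA AAA _]; exact: sum_le_Amax.
rewrite sumr_const -[leLHS]mulr_natr ler_wpM2l ?Amax_ge0 //.
rewrite cardsD (finset.setIidPr TC) cardT natrB ?geq_minr //.
rewrite le_max; apply/orP; rewrite /minn; case: ltnP => BC.
  by right; rewrite lerD2r ler_nat.
by left; rewrite subrr.
Qed.

End Clearing.

(** * A quadratic smoothing of the positive part *)

Section SmoothedPenalty.
Variables (R : realType) (rho c : R).
Hypotheses (rho_gt0 : 0 < rho) (c_ge0 : 0 <= c).
Implicit Types r s m : R.

Definition multiplier r : R := Num.max 0 (Num.min c (r / rho)).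

(* The maximum over m in [0, c] of m r - rho m^2 / 2, a smoothing of
   c max(r, 0), is attained at [multiplier r], which is its derivative. *)
Definition penalty r : R := multiplier r * r - rho / 2 * multiplier r ^+ 2.

Lemma multiplier_itv r : 0 <= multiplier r <= c.
Proof.
by rewrite /multiplier le_max lexx ge_max c_ge0 /= ge_min lexx.
Qed.

(** The first-order optimality condition for the concave maximization over [[0, c]] that defines
    [penalty]. *)
Lemma multiplier_optimal r m : 0 <= m <= c ->
  (m - multiplier r) * (r - rho * multiplier r) <= 0.
Proof.
move=> /andP[m0 mc]; rewrite /multiplier.
have er : r = rho * (r / rho) by rewrite mulrC divfK // gt_eqF.
set s := r / rho in er *; rewrite {1}er -mulrBr mulrCA.
rewrite pmulr_rle0 // maxEle minEle.
clear er; case: (leP c s) => cs; first by rewrite c_ge0; nra.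
by case: (leP 0 s) => ?; nra.
Qed.

Lemma penalty_ge0 r : 0 <= penalty r.
Proof.
have := @multiplier_optimal r 0; rewrite lexx => /(_ c_ge0).
have /andP[] := multiplier_itv r; rewrite /penalty.
have := mulr_ge0 (ltW rho_gt0) (sqr_ge0 (multiplier r)); nra.
Qed.

Lemma le_penalty r : c * Num.max 0 r <= penalty r + rho / 2 * c ^+ 2.
Proof.
case: (leP 0 r) => r0; last first.
  rewrite mulr0 addr_ge0 ?penalty_ge0 // mulr_ge0 ?sqr_ge0 //.
  by rewrite divr_ge0 // ltW.
have := @multiplier_optimal r c; rewrite lexx c_ge0 => /(_ isT).
have := mulr_ge0 (ltW rho_gt0) (sqr_ge0 (c - multiplier r)).
rewrite /penalty; nra.
Qed.

(** The descent inequality for a function whose derivative is [1 / rho]-Lipschitz. It follows from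
    optimality of [multiplier r] against [multiplier s] and from completing a square. *)
Lemma penalty_smooth r s :
  penalty s <= penalty r + multiplier r * (s - r) + (s - r) ^+ 2 / (2 * rho).
Proof.
have := @multiplier_optimal r (multiplier s) (multiplier_itv s).
rewrite /penalty; set u := multiplier s; set v := multiplier r => opt.
have := mulr_ge0 (ltW rho_gt0) (sqr_ge0 (u - v - (s - r) / rho)).
have -> : rho * (u - v - (s - r) / rho) ^+ 2
  = rho * (u - v) ^+ 2 - 2 * (u - v) * (s - r) + 2 * ((s - r) ^+ 2 / (2 * rho)).
  by field; rewrite gt_eqF.
nra.
Qed.

End SmoothedPenalty.

(** * Approximate linear programming duality by smoothing *)

Section ApproximateDuality.
Variables (R : realType) (load : finType) (AA : {set {set load}}) (B : nat).
Variables (a p : load -> R).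
Hypothesis a_gt0 : forall l, 0 < a l.
Implicit Types (x : {set load} -> R) (A : {set load}).

Definition fractional_plan x : Prop :=
  (forall A, 0 <= x A) /\ \sum_(A in AA) x A <= B%:R.

Lemma coverage_itv x l : fractional_plan x -> 0 <= coverage AA x l <= B%:R.
Proof.
move=> [x0 xB]; rewrite sumr_ge0 //=; apply: le_trans xB.
rewrite /coverage [leRHS](bigID (fun A => l \in A)) /= lerDl.
exact: sumr_ge0.
Qed.

(* An almost minimizer of the total smoothed penalty cannot be improved much
   by moving a little towards the plan that executes the set with the largest
   total multiplier [B] times. *)
Lemma approximate_multipliers rho e : 0 < rho -> 0 < e ->
  (exists A, A \in AA) ->
  exists x, fractional_plan x /\
    exists2 A, A \in AA &
    let m l := multiplier rho (a l) (p l - coverage AA x l) in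
    (forall A', A' \in AA -> \sum_(l in A') m l <= \sum_(l in A) m l) /\
    B%:R * \sum_(l in A) m l - \sum_l m l * coverage AA x l <= e.
Proof.
move=> rho0 e0 [A0 A0AA].
pose f x := \sum_l penalty rho (a l) (p l - coverage AA x l).
pose E := f @` [set x | fractional_plan x].
have f0 x : 0 <= f x.
  by apply: sumr_ge0 => l _; apply: penalty_ge0 => //; exact: ltW.
have hasE : has_inf E.
  split; last by exists 0 => _ [x _ <-].
  by exists (f (fun=> 0)); exists (fun=> 0) => //; split=> //; rewrite big1.
(* [t ^+ 2 * K] bounds the total second-order term of a step of length [t], since each coverage then
   moves by at most [t * B%:R]. *)
pose K : R := #|load|%:R * (B%:R ^+ 2 / (2 * rho)).
have K0 : 0 <= K.
  by rewrite mulr_ge0 // divr_ge0 ?sqr_ge0 // mulr_ge0 // ltW.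
pose t := Num.min 1 (e / (1 + K)).
have t0 : 0 < t by rewrite lt_min ltr01 divr_gt0 // ltr_wpDr.
have t1 : t <= 1 by rewrite ge_min lexx.
have te : t * (1 + K) <= e.
  by rewrite -ler_pdivlMr ?ge_min ?lexx ?orbT // ltr_wpDr.
(* Precision [t ^+ 2] matches the second-order term: dividing [t ^+ 2 * (1 + K)] by [t] leaves at
   most [e]. *)
have [_ [x planx <-] fx] := inf_adherent (exprn_gt0 2 t0) hasE.
exists x; split=> //.
pose m l := multiplier rho (a l) (p l - coverage AA x l).
case: (@arg_maxP _ _ _ A0 (mem AA) (fun A => \sum_(l in A) m l) A0AA) => A; rewrite -/(A \in AA) => AAA maxA.
exists A => //=; split=> //; rewrite -/m.
pose x' A' := (1 - t) * x A' + t * B%:R * (A' == A)%:R.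
(* Used with the full predicate for the total weight of [x'] and with membership of a load for its
   coverage. *)
have sumA (P : pred {set load}) :
    \sum_(A' in AA | P A') (A' == A)%:R = (P A)%:R :> R.
  have [PA|PA] := boolP (P A).
    rewrite (bigD1 A) ?AAA //= eqxx big1 ?addr0 // => A' /andP[_ /negPf ->] //.
  rewrite big1 // => A' /andP[_ PA']; case: eqP => // e'.
  by rewrite -e' PA' in PA.
have planx' : fractional_plan x'.
  have [x0 xB] := planx; split=> [A'|].
    by rewrite addr_ge0 ?mulr_ge0 // ?subr_ge0 // ltW.
  rewrite big_split /= -!mulr_sumr.
  have := sumA xpredT; under eq_bigl do rewrite andbT; move=> -> /=; nra.
have cov' l : coverage AA x' l
    = (1 - t) * coverage AA x l + t * B%:R * (l \in A)%:R.
  by rewrite /coverage big_split /= -!mulr_sumr sumA.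
have fx' : f x <= f x' + t ^+ 2.
  by apply/ltW/(lt_le_trans fx); rewrite lerD2r; apply: (ge_inf hasE.2); exists x'.
have step : f x' <= f x
    - t * (B%:R * \sum_(l in A) m l - \sum_l m l * coverage AA x l) + t ^+ 2 * K.
  have -> : f x - t * (B%:R * \sum_(l in A) m l
      - \sum_l m l * coverage AA x l) + t ^+ 2 * K
    = \sum_l (penalty rho (a l) (p l - coverage AA x l)
        - t * (B%:R * ((l \in A)%:R * m l) - m l * coverage AA x l)
        + t ^+ 2 * (B%:R ^+ 2 / (2 * rho))).
    rewrite big_split sumrB -mulr_sumr sumr_const /=; congr (_ - _ * _ + _).
      rewrite sumrB -mulr_sumr (big_mkcond (mem A)) /=; congr (_ * _ - _).
      by apply: eq_bigr => l _; case: ifP => _; rewrite ?mul1r ?mul0r.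
    by rewrite /K mulr_natl mulrnAr.
  apply: ler_sum => l _.
  apply: le_trans (penalty_smooth rho0 (ltW (a_gt0 l)) (p l - coverage AA x l) _) _.
  rewrite -/(m l) cov'; have /andP[c0 cB] := coverage_itv l planx.
  have sqB : (t * (B%:R * (l \in A)%:R - coverage AA x l)) ^+ 2
      <= t ^+ 2 * B%:R ^+ 2.
    rewrite exprMn ler_wpM2l ?sqr_ge0 //.
    by case: (l \in A); rewrite ?mulr1 ?mulr0; nra.
  have -> : p l - ((1 - t) * coverage AA x l + t * B%:R * (l \in A)%:R)
      - (p l - coverage AA x l) = - (t * (B%:R * (l \in A)%:R - coverage AA x l)).
    by ring.
  rewrite sqrrN; apply: lerD; first by rewrite le_eqVlt; apply/orP; left; apply/eqP; ring.
  by rewrite [leRHS]mulrA ler_wpM2r // invr_ge0 mulr_ge0 // ltW.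
set G := B%:R * _ - _ in step *.
apply: le_trans te; rewrite -(ler_pM2l t0); nra.
Qed.

(** The multipliers of an almost minimizer, with [mu] their largest sum over a member of [AA], form
    a dual feasible point. Its value is at most [V], and the gap bound compares it with the smoothed
    cost. *)
Lemma approximate_strong_duality V e : 0 < e -> (exists A, A \in AA) ->
  (forall lam mu, dual_feasible AA a lam mu -> dual_value B p lam mu <= V) ->
  exists2 x, fractional_plan x &
    \sum_l a l * Num.max 0 (p l - coverage AA x l) <= V + e.
Proof.
move=> e0 exA V_ub.
pose s := \sum_l a l ^+ 2.
have s0 : 0 <= s by apply: sumr_ge0 => l _; exact: sqr_ge0.
(* Keeps the total smoothing error [rho / 2 * s] below [e / 2]; the other half of [e] pays for the
   multiplier gap. *)
pose rho := e / (1 + s).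
have rho0 : 0 < rho by rewrite divr_gt0 // ltr_wpDr.
have rhos : rho * s <= e.
  rewrite /rho mulrAC ler_pdivrMr ?ltr_wpDr // ler_wpM2l ?(ltW e0) //.
  by rewrite lerDr.
have e20 : 0 < e / 2 by rewrite divr_gt0.
have [x [planx [A AAA [maxA gap]]]] := approximate_multipliers rho0 e20 exA.
exists x => //; move: maxA gap.
set m := fun l => multiplier rho (a l) (p l - coverage AA x l) => maxA gap.
have m_itv l : 0 <= m l <= a l by apply: multiplier_itv; exact: ltW.
have m0 l : 0 <= m l by case/andP: (m_itv l).
have : dual_value B p m (\sum_(l in A) m l) <= V.
  by apply: V_ub; split=> //; exact: sumr_ge0.
rewrite /dual_value => dualV.
apply: le_trans (_ : _ <= \sum_l (m l * p l - m l * coverage AA x l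
    + rho / 2 * a l ^+ 2)) _.
  apply: ler_sum => l _; apply: le_trans (le_penalty rho0 (ltW (a_gt0 l)) _) _.
  rewrite lerD2r /penalty -/(m l) -mulrBr gerBl.
  by rewrite mulr_ge0 ?sqr_ge0 // divr_ge0 // ltW.
by rewrite big_split /= sumrB -mulr_sumr -/s; lra.
Qed.

End ApproximateDuality.

(** * Expected clearing cost against the dual optimum *)

Section ClearingExpectation.
Variables (R : realType) (load : finType) (AA : {set {set load}}) (B : nat).
Variables (a p : load -> R) (gamma V : R).
Hypothesis AA_cover : forall l, exists2 A : {set load}, A \in AA & l \in A.
Hypothesis a_gt0 : forall l, 0 < a l.
Hypothesis load_gt0 : (0 < #|load|)%N.
Hypothesis p01 : forall l, 0 <= p l <= 1.
Hypothesis gamma_ge0 : 0 <= gamma.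
Hypothesis substitutable : forall X : load -> R, (forall l, 0 <= X l) ->
  contracts AA (fun l => X l / 2) <= contracts AA X / 2 + gamma.
Hypothesis V_ub : forall lam mu,
  dual_feasible AA a lam mu -> dual_value B p lam mu <= V.

(* The demand served by contracts is truncated at [1 - delta] so that its
   integer part vanishes, which makes [contracts] the expected size of an
   optimal cover of a Bernoulli vector. *)
Lemma clearing_expect_le :
  bernoulli_expect p (clearing AA B a)
  <= V + Amax AA a * (Num.sqrt #|load|%:R / 2 + 2 * gamma).
Proof.
apply/ler_addgt0Pr => e e0.
have exA : exists A, A \in AA.
  by move/card_gt0P: load_gt0 => [l _]; have [A AAA _] := AA_cover l; exists A.
have e20 : 0 < e / 2 by rewrite divr_gt0.
have [x [x0 xB] costx] := approximate_strong_duality a_gt0 e20 exA V_ub.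
pose s := \sum_l a l.
have s0 : 0 <= s by apply: sumr_ge0 => l _; exact: ltW.
(* Truncating at [1 - delta] sends at most [delta] more of each load to the alternate channel, for
   at most [e / 2] in total. *)
pose delta := Num.min 1 (e / 2 / (1 + s)).
have delta0 : 0 < delta by rewrite lt_min ltr01 divr_gt0 // ltr_wpDr.
have delta1 : delta <= 1 by rewrite ge_min lexx.
have deltas : delta * s <= e / 2.
  apply: le_trans (_ : delta * (1 + s) <= _); first by rewrite ler_wpM2l ?lerDr // ltW.
  by rewrite -ler_pdivlMr ?ge_min ?lexx ?orbT // ltr_wpDr.
pose d l := Num.min (Num.min (p l) (coverage AA x l)) (1 - delta).
have cov0 l : 0 <= coverage AA x l by exact: sumr_ge0.
have d0 l : 0 <= d l.
  by rewrite !le_min cov0 subr_ge0 delta1; case/andP: (p01 l) => ->.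
have d_lt1 l : d l < 1 by rewrite gt_min gtrBl delta0 orbT.
have d01 l : 0 <= d l <= 1 by rewrite d0 ltW.
have dp l : 0 <= d l <= p l by rewrite d0 !ge_min lexx.
have dcov l : 0 <= d l <= coverage AA x l by rewrite d0 !ge_min lexx orbT.
have p1 l : p l <= 1 by case/andP: (p01 l).
apply: le_trans (bernoulli_expect_incr dp p1 (fun l => ltW (a_gt0 l))
  (@clearing_setc _ _ _ _ _ a_gt0)) _.
have cost_alt : \sum_l a l * (p l - d l) <= V + e.
  apply: le_trans (_ : _ <=
    \sum_l (a l * Num.max 0 (p l - coverage AA x l) + delta * a l)) _.
    apply: ler_sum => l _; rewrite [delta * _]mulrC -mulrDr ler_wpM2l ?(ltW (a_gt0 l)) //.
    set M := Num.max _ _.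
    have M0 : 0 <= M by rewrite le_max lexx.
    have Mcov : p l - coverage AA x l <= M by rewrite le_max lexx orbT.
    have := p1 l; rewrite lerBlDl -lerBlDr !le_min => pl1.
    by apply/andP; split; [apply/andP; split|]; lra.
  by rewrite big_split /= -mulr_sumr -/s; lra.
have cost_clear : bernoulli_expect d (clearing AA B a)
    <= Amax AA a * (Num.sqrt #|load|%:R / 2 + 2 * gamma).
  apply: le_trans (bernoulli_expect_le d01 (clearing_le_excess B AA_cover a_gt0)) _.
  rewrite bernoulli_expectZ ler_wpM2l ?Amax_ge0 //.
  apply: le_trans (contracts_nat_excess AA_cover _ load_gt0 d01) _.
  rewrite lerD2l ge_max mulr_ge0 //= -contracts_expect => [|l]; last by rewrite d0 d_lt1.
  have := contracts_le_fractional AA_cover substitutable gamma_ge0 x0 dcov; lra.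
lra.
Qed.

End ClearingExpectation.

(** * Dual values in expectation, feasibility of the iterates, and the guarantee *)

Lemma bernoulli_expect_dual_value (R : realType) (load : finType) (B : nat)
    (p lam : load -> R) (mu : R) :
  bernoulli_expect p (fun X => dual_value B (fun l => (X l)%:R) lam mu)
  = dual_value B p lam mu.
Proof.
rewrite /dual_value bernoulli_expectD bernoulli_expect_cst; congr (_ - _).
rewrite bernoulli_expect_sum; apply: eq_bigr => l _.
by rewrite bernoulli_expectZ bernoulli_expect_coord.
Qed.

(** The origin is feasible and each update is a convex combination of feasible points, as the step
    size lies in [[0, 1]]. *)
Lemma dfw_iter_feasible (R : realType) (load : finType)
    (AA : {set {set load}}) (B : nat) (a : load -> R) (q : load -> R -> R)
    (eps : R) t lam mu : (forall l, 0 <= a l) ->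
  dfw_iter AA B a q eps t lam mu -> dual_feasible AA a lam mu.
Proof.
move=> a0; elim=> {t lam mu} [|t lam mu hlam hmu _ [lamA lam_a mu0]
  [[hlamA hlam_a hmu0] _] _].
  by split=> // [A _|l]; [rewrite big1 | rewrite lexx a0].
have eta0 : 0 <= dfw_eta R t by rewrite divr_ge0.
have eta1 : 0 <= 1 - dfw_eta R t.
  by rewrite subr_ge0 ler_pdivrMr ?mul1r ?lerDr ?ltr_wpDl.
split=> [A AAA|l|]; last by rewrite addr_ge0 ?mulr_ge0.
  rewrite big_split /= -!mulr_sumr.
  by apply: lerD; rewrite ler_wpM2l ?lamA ?hlamA.
have /andP[l0 la] := lam_a l; have /andP[h0 ha] := hlam_a l.
rewrite addr_ge0 ?mulr_ge0 //=.
have -> : a l = (1 - dfw_eta R t) * a l + dfw_eta R t * a l by ring.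
by rewrite lerD // ler_wpM2l.
Qed.

Theorem theorem2 (R : realType) (load : finType) (a : load -> R) (B : nat)
  (AA : {set {set load}}) (nu : R)
  (policy : load -> Type) (S Q : forall l, policy l -> R)
  (Pstar : forall l, R -> policy l) (beta : load -> R) (gamma : R)
  (eps : R) (lam : load -> R) (mu : R)
  (a_gt0 : forall l, 0 < a l)
  (AA_down : forall A A' : {set load}, A \in AA -> A' \subset A -> A' \in AA)
  (AA_cover : forall l, exists2 A : {set load}, A \in AA & l \in A)
  (nu_gt0 : 0 < nu) (nu_lt : nu < 1 / 2)
  (B_gt : nu * #|load|%:R < B%:R)
  (uB_lt : ((\max_(A in AA) #|A|) * B)%:R < (1 - nu) * #|load|%:R)
  (policy_inh : forall l, inhabited (policy l))
  (S_ge0 : forall l P, 0 <= S l P)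
  (Q_01 : forall l P, 0 <= Q l P <= 1)
  (oracle : forall l w, 0 <= w -> forall P,
     S l (Pstar l w) + Q l (Pstar l w) * w <= S l P + Q l P * w)
  (oracle0 : forall l, Q l (Pstar l 0) = 1)
  (beta_gt0 : forall l, 0 < beta l)
  (Q_lipschitz : forall l,
     (beta l).-lipschitz_[set w : R | 0 <= w] (spot_prob Q Pstar l))
  (gamma_ge0 : 0 <= gamma) (gamma_lt : gamma < B%:R / 4)
  (substitutable : forall X : load -> R, (forall l, 0 <= X l) ->
     contracts AA (fun l => X l / 2) <= contracts AA X / 2 + gamma)
  (eps_gt0 : 0 < eps)
  (output : dfw_output AA B a (spot_prob Q Pstar) eps lam mu) :
  alg_cost AA B a S Q Pstar lam - opt_cost AA B a S Q
  <= Amax AA a * (Num.sqrt #|load|%:R / 2 + 2 * gamma * log2 (4 * #|load|%:R))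
     + eps.

Proof.
have [t [hlam [hmu [iter [_ hmax] gap]]]] := output.
have a_ge0 l : 0 <= a l by exact: ltW.
have feas := dfw_iter_feasible a_ge0 iter.
have [_ lam_a _] := feas.
(* Without loads, [uB_lt] would put a natural number strictly below 0. *)
have L0 : (0 < #|load|)%N.
  by rewrite lt0n; apply/eqP => L0; move: uB_lt; rewrite L0 mulr0 ltrn0.
pose q := dfw_prob (spot_prob Q Pstar) lam.
(* The oracle at price [lam l] handles each load separately; weak duality, averaged over [X],
   handles the clearing cost. *)
have spot_le P : \sum_l spot_pay S Pstar l (lam l) + dual_value B q lam mu
    <= policy_cost AA B a S Q P.
  apply: le_trans (_ : _ <= \sum_l S l (P l)
    + dual_value B (fun l => Q l (P l)) lam mu) _.
    rewrite /dual_value !addrA lerD2r -!big_split; apply: ler_sum => l _ /=.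
    by rewrite ![lam l * _]mulrC; apply: oracle; case/andP: (lam_a l).
  rewrite lerD2l -bernoulli_expect_dual_value; apply: bernoulli_expect_le => // X.
  exact: clearing_weak_duality.
have opt_ge : \sum_l spot_pay S Pstar l (lam l) + dual_value B q lam mu
    <= opt_cost AA B a S Q.
  apply: lb_le_inf => [|_ [P _ <-]]; last exact: spot_le.
  by exists (policy_cost AA B a S Q (fun l => Pstar l 0)), (fun l => Pstar l 0).
have q01 l : 0 <= q l <= 1 by exact: Q_01.
(* Here [V] is the dual value of the maximizer [(hlam, hmu)] at [q], which exceeds that of
   [(lam, mu)] by at most [eps] when the algorithm stops. *)
have := clearing_expect_le AA_cover a_gt0 L0 q01 gamma_ge0 substitutable hmax.
have log_ge1 : 1 <= log2 (4 * #|load|%:R : R).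
  have ln2 : 0 < ln (2 : R) by rewrite ln_gt0 // ltr1n.
  rewrite /log2 ler_pdivlMr // mul1r ler_ln ?posrE ?mulr_gt0 ?ltr0n //.
  have : (1 : R) <= #|load|%:R by rewrite ler1n.
  lra.
have := ler_wpM2l (Amax_ge0 AA a) (_ : Num.sqrt #|load|%:R / 2 + 2 * gamma
  <= Num.sqrt #|load|%:R / 2 + 2 * gamma * log2 (4 * #|load|%:R)).
rewrite lerD2l ler_peMr ?mulr_ge0 // => /(_ isT).
move: gap; rewrite /dfw_gap /alg_cost -/q; lra.
Qed.
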